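(* Suppose that the components of $T$ are affine independent on $\mathrm{supp}\, f$, i.e. for every $(0,0)\neq(\lambda,\mu)\in\mathbb{R}^L\times\mathbb{R}$ there exists $x\in\mathrm{supp}\, f$ with $\langle\lambda,T(x)\rangle+\mu\neq 0$, and that $\bar T\in\mathrm{int}(\mathrm{co}\,T(D_M))$ for every $M$. Suppose also that $\lim_{M\to\infty}\sum_{i=1}^{I_M}q_{i,M}h(x_{i,M})=\int_{\mathbb{R}^K}f(x)h(x)\,dx$ for every bounded continuous $h:\mathbb{R}^K\to\mathbb{R}$, and that $\lim_{M\to\infty}\sum_{i=1}^{I_M}q_{i,M}T(x_{i,M})=\int_{\mathbb{R}^K}f(x)T(x)\,dx$. Let $g:\mathbb{R}^K\to\mathbb{R}$ be a bounded continuous function. Then for any $C$ with $0<C<C_\infty$ there exists a positive integer $M_C$ such that for all $M\ge M_C$, $$E^{(P)}_{g,M}\le E^{(Q)}_{g,M}+\|g\|_\infty\sqrt{-2\log\left(1-\frac{(E^{(Q)}_{T,M})^2}{2C}\right)},$$ where the right-hand side is interpreted as $\infty$ if the argument of the logarithm is nonpositive.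
   Context: $f$ is a probability density on $\mathbb{R}^K$ and $\mathrm{supp}\, f$ is its support (the support of the measure $f(x)\,dx$). $T:\mathbb{R}^K\to\mathbb{R}^L$ is continuous, with finite moment $\bar T=\int_{\mathbb{R}^K}f(x)T(x)\,dx$. For each positive integer $M$, $D_M=\{x_{i,M}\mid i=1,\dots,I_M\}\subset\mathbb{R}^K$ is a given finite set of $I_M$ points, and $Q_M=\{q_{i,M}\}_{i=1}^{I_M}$ is a given probability distribution on $D_M$, with $q_{i,M}>0$ and $\sum_{i=1}^{I_M}q_{i,M}=1$. $\mathrm{co}\,T(D_M)$ is the convex hull of $\{T(x_{i,M})\}_{i=1}^{I_M}$ and $\mathrm{int}$ is the interior in $\mathbb{R}^L$. $\langle\cdot,\cdot\rangle$ and $\|\cdot\|$ are the usual inner product and norm on $\mathbb{R}^L$; $\|g\|_\infty=\sup_{x\in\mathbb{R}^K}|g(x)|$. When $\bar T\in\mathrm{int}(\mathrm{co}\,T(D_M))$, let $\lambda_M\in\mathbb{R}^L$ be the (unique) maximizer over $\lambda\in\mathbb{R}^L$ of $\langle\lambda,\bar T\rangle-\log\left(\sum_{i=1}^{I_M}q_{i,M}e^{\langle\lambda,T(x_{i,M})\rangle}\right)$, and define the probability distribution $P_M=\{p_{i,M}\}$ on $D_M$ by $$p_{i,M}=\frac{q_{i,M}e^{\langle\lambda_M,T(x_{i,M})\rangle}}{\sum_{j=1}^{I_M}q_{j,M}e^{\langle\lambda_M,T(x_{j,M})\rangle}}.$$ (Equivalently, $P_M$ is the unique minimizer of $\sum_i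 p_i\log(p_i/q_{i,M})$ subject to $\sum_i p_iT(x_{i,M})=\bar T$, $\sum_i p_i=1$, $p_i\ge0$, with $0\log 0=0$.) Errors: $E^{(Q)}_{g,M}=\left|\int_{\mathbb{R}^K}f(x)g(x)\,dx-\sum_{i=1}^{I_M}q_{i,M}g(x_{i,M})\right|$, $E^{(P)}_{g,M}=\left|\int_{\mathbb{R}^K}f(x)g(x)\,dx-\sum_{i=1}^{I_M}p_{i,M}g(x_{i,M})\right|$, and $E^{(Q)}_{T,M}=\left\|\int_{\mathbb{R}^K}f(x)T(x)\,dx-\sum_{i=1}^{I_M}q_{i,M}T(x_{i,M})\right\|$. For $\alpha>0$, $C_\alpha=\inf_{\lambda\in\mathbb{R}^L,\|\lambda\|=1}\int_{\mathbb{R}^K}f(x)\left(\max\{0,\min\{\langle\lambda,T(x)-\bar T\rangle,\alpha\}\}\right)^2dx$, and $C_\infty=\lim_{\alpha\to\infty}C_\alpha\in[0,\infty]$. *)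

(* Defs.v *)
From HB Require Import structures.
From mathcomp Require Import all_boot all_order all_algebra.
From mathcomp Require Import all_classical all_reals all_analysis.
From mathcomp Require Import measurable_realfun lra.

Set Implicit Arguments.
Unset Strict Implicit.
Unset Printing Implicit Defensive.

Import Order.TTheory GRing.Theory Num.Theory.
Import numFieldNormedType.Exports.

Local Open Scope classical_set_scope.
Local Open Scope ring_scope.

Section borel_matrix.
Context {R : realType} {m n : nat}.

HB.instance Definition _ := @isMeasurable.Build
  (sigma_display (@open 'M[R]_(m, n))) 'M[R]_(m, n) <<s @open 'M[R]_(m, n) >>
  (@sigma_algebra0 _ setT _) (@sigma_algebraC _ _)
  (@sigma_algebra_bigcup _ setT _).

Lemma open_measurable_mx (U : set 'M[R]_(m, n)) : open U -> measurable U.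
Proof. by move=> oU; apply: sub_sigma_algebra. Qed.

End borel_matrix.

(* The map (x_0, (x_1, ..., x_K)) |-> (x_0, ..., x_K). *)
Definition rV_cons (R : realType) (K : nat)
    (p : measurableTypeR R * 'rV[R]_K) : 'rV[R]_K.+1 :=
  row_mx (n1 := 1) (p.1 : R)%:M p.2.

Lemma rV_cons0 (R : realType) K (p : measurableTypeR R * 'rV[R]_K) :
  rV_cons p 0 0 = p.1.
Proof.
rewrite /rV_cons.
have -> : (0 : 'I_K.+1) = lshift K (0 : 'I_1) by apply/val_inj.
by rewrite (@row_mxEl R 1 1 K) mxE eqxx.
Qed.

Lemma rV_consS (R : realType) K (p : measurableTypeR R * 'rV[R]_K) (i : 'I_K) :
  rV_cons p 0 (lift ord0 i) = p.2 0 i.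
Proof.
rewrite /rV_cons.
have -> : lift ord0 i = rshift 1 i by apply/val_inj.
by rewrite (@row_mxEr R 1 1 K).
Qed.

Lemma ball_rV_cons (R : realType) K (x : 'rV[R]_K.+1) (e : R)
    (p : measurableTypeR R * 'rV[R]_K) :
  ball x e (rV_cons p) <->
  ball (x 0 0) e (p.1 : R) /\ ball (\row_i x 0 (lift ord0 i)) e p.2.
Proof.
split=> [[e0 H]|[H0 [e0 H]]].
  split; first by have := H 0 0; rewrite rV_cons0.
  split=> // i j; rewrite (ord1 i) mxE.
  by have := H 0 (lift ord0 j); rewrite rV_consS.
split=> // i j; rewrite (ord1 i).
case: (unliftP ord0 j) => [k ->|->]; last by rewrite rV_cons0.
by rewrite rV_consS; have := H 0 k; rewrite mxE.
Qed.

Lemma open_rV_bigcup (R : realType) n (U : set 'rV[R]_n) : open U ->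
  U = \bigcup_(qk in [set qk : 'rV[rat]_n * nat |
        ball (map_mx ratr qk.1 : 'rV[R]_n) (qk.2.+1%:R^-1) `<=` U])
      ball (map_mx ratr qk.1 : 'rV[R]_n) (qk.2.+1%:R^-1).
Proof.
move=> oU; apply/seteqP; split=> [x Ux|x [qk]]; last by apply.
have /nbhs_ballP[e/= e0 eU] : nbhs x U by exact: open_nbhs_nbhs.
have [k ke] : exists k : nat, k.+1%:R^-1 < e / 2.
  have e20 : 0 < e / 2 by rewrite divr_gt0.
  exists (Num.truncn ((e / 2)^-1)).
  by rewrite invf_plt ?posrE// truncnS_gt.
pose r : R := k.+1%:R^-1.
have r0 : 0 < r by rewrite invr_gt0.
have q_ (j : 'I_n) : {q : rat | ratr q \in `]x 0 j - r, x 0 j + r[}.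
  apply: cid; apply: rat_in_itvoo.
  by rewrite ltrBlDr -addrA ltrDl addr_gt0.
have xq : ball (map_mx ratr (\row_j sval (q_ j)) : 'rV[R]_n) r x.
  split=> // i j; rewrite (ord1 i) !mxE.
  case: (q_ j) => q /=; rewrite in_itv/= /ball/= => /andP[q1 q2].
  by rewrite ltr_distl; apply/andP; split; lra.
exists (\row_j sval (q_ j), k) => //= y qy; apply: eU.
apply: (@le_ball _ _ _ (r + r)).
  by rewrite (splitr e) lerD// ltW.
by apply: ball_triangle qy; exact: ball_sym.
Qed.

Lemma measurable_rV_coord (R : realType) n (j : 'I_n) :
  measurable_fun setT (fun x : 'rV[R]_n => x 0 j : measurableTypeR R).
Proof.
apply: (measurability _ (RGenOpens.measurableE R)).
move=> _ [_ [a [b ->] <-]]; rewrite setTI; apply: open_measurable_mx.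
have /continuousP := @coord_continuous R 1 n 0 j.
by apply; exact: interval_open.
Qed.

Section lebesgue_rV_step.
Context {R : realType} {K : nat}.
Variable mu : {sigma_finite_measure set 'rV[R]_K -> \bar R}.

Lemma measurable_rV_cons : measurable_fun setT (@rV_cons R K).
Proof.
apply: (measurability (@open 'rV[R]_K.+1)) => // _ [U oU <-].
rewrite setTI (open_rV_bigcup oU) preimage_bigcup bigcup_mkcond.
apply: countable_bigcupT_measurable => [|qk]; first exact: countableP.
case: ifP => _; last exact: measurable0.
set q : 'rV[R]_K.+1 := map_mx _ _.
have -> : @rV_cons R K @^-1` ball q qk.2.+1%:R^-1 =
    ball (q 0 0 : R) qk.2.+1%:R^-1 `*`
    ball (\row_i q 0 (lift ord0 i)) qk.2.+1%:R^-1.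
  by apply/seteqP; split=> p /ball_rV_cons.
apply: measurableX; first exact: measurable_ball.
by apply: open_measurable_mx; exact: ball_open.
Qed.

Lemma measurable_rV_behead :
  measurable_fun setT (fun x : 'rV[R]_K.+1 => \row_i x 0 (lift ord0 i)).
Proof.
apply: (measurability (@open 'rV[R]_K)) => // _ [U oU <-].
rewrite setTI; apply: open_measurable_mx.
have : continuous (fun x : 'rV[R]_K.+1 => \row_i x 0 (lift ord0 i)).
  move=> x A /nbhs_ballP[e e0 eA]; apply/nbhs_ballP; exists e => //= y [_ xy].
  by apply: eA; split=> // i j; rewrite !mxE; exact: xy.
by move/continuousP; apply.
Qed.

Definition lebesgue_rV_step : set 'rV[R]_K.+1 -> \bar R :=
  pushforward (lebesgue_measure \x mu)%E (@rV_cons R K).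

Let step0 : lebesgue_rV_step set0 = 0%E.
Proof. by rewrite /lebesgue_rV_step /pushforward preimage_set0 measure0. Qed.

Let step_ge0 A : (0 <= lebesgue_rV_step A)%E.
Proof. by rewrite /lebesgue_rV_step /pushforward; exact: measure_ge0. Qed.

Let step_sigma_additive : semi_sigma_additive lebesgue_rV_step.
Proof.
move=> F mF tF mUF; rewrite /lebesgue_rV_step /pushforward preimage_bigcup.
have mp (B : set 'rV[R]_K.+1) : measurable B ->
    measurable (@rV_cons R K @^-1` B).
  by move=> mB; rewrite -[X in measurable X]setTI; exact: measurable_rV_cons.
apply: measure_semi_sigma_additive.
- by move=> n; exact: mp.
- apply/trivIsetP => /= i j _ _ ij; rewrite -preimage_setI.
  by move/trivIsetP : tF => /(_ _ _ _ _ ij) ->//; rewrite preimage_set0.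
- by rewrite -preimage_bigcup; exact: mp.
Qed.

HB.instance Definition _ := isMeasure.Build _ _ _
  lebesgue_rV_step step0 step_ge0 step_sigma_additive.

Lemma lebesgue_rV_step_box (A : set R) (B : set 'rV[R]_K) :
  measurable (A : set (measurableTypeR R)) -> measurable B ->
  lebesgue_rV_step [set x | A (x 0 0) /\ B (\row_i x 0 (lift ord0 i))] =
  (lebesgue_measure A * mu B)%E.
Proof.
move=> mA mB; rewrite -product_measure1E//; congr (product_measure1 _ _ _).
apply/seteqP; split=> p /=; rewrite rV_cons0;
  by rewrite (_ : \row__ _ = p.2)//; apply/rowP => i; rewrite mxE rV_consS.
Qed.

Let step_sigma_finite : sigma_finite setT lebesgue_rV_step.
Proof.
have /sigma_finiteP[F [TF ndF mF]] := sigma_finiteT (@lebesgue_measure R).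
have /sigma_finiteP[G [TG ndG mG]] := sigma_finiteT mu.
exists (fun n => [set x : 'rV[R]_K.+1 | F n (x 0 0) /\ G n (\row_i x 0 (lift ord0 i))]).
  apply/esym; rewrite -subTset => x _.
  have [i _ Fi] : (\bigcup_i F i) (x 0 0) by rewrite -TF.
  have [j _ Gj] : (\bigcup_i G i) (\row_i x 0 (lift ord0 i)) by rewrite -TG.
  exists (maxn i j) => //; split.
  - by move: Fi; apply/subsetPset/ndF/leq_maxl.
  - by move: Gj; apply/subsetPset/ndG/leq_maxr.
move=> n; have [mFn Fn] := mF n; have [mGn Gn] := mG n; split; last first.
  by rewrite lebesgue_rV_step_box// lte_mul_pinfty// ge0_fin_numE.
apply: measurableI.
  by rewrite -[X in measurable X]setTI; exact: measurable_rV_coord.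
by rewrite -[X in measurable X]setTI; exact: measurable_rV_behead.
Qed.

HB.instance Definition _ := Measure_isSigmaFinite.Build _ _ _
  lebesgue_rV_step step_sigma_finite.

End lebesgue_rV_step.

Fixpoint lebesgue_rV (R : realType) (K : nat) :
    {sigma_finite_measure set 'rV[R]_K -> \bar R} :=
  match K with
  | 0 => [the sigma_finite_measure _ _ of \d_(0 : 'rV[R]_0)]
  | K'.+1 => [the sigma_finite_measure _ _ of
               lebesgue_rV_step (@lebesgue_rV R K')]
  end.
Arguments lebesgue_rV {R K}.

Lemma lebesgue_rV_box (R : realType) K (A : 'I_K -> set R) :
  (forall i, measurable (A i : set (measurableTypeR R))) ->
  lebesgue_rV [set x : 'rV[R]_K | forall i, A i (x 0 i)] =
  (\prod_(i < K) lebesgue_measure (A i))%E.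
Proof.
elim: K A => [|K IH] A mA.
  rewrite big_ord0 /= diracE mem_set//= => i; by case: i.
have mB : measurable [set x : 'rV[R]_K | forall i, A (lift ord0 i) (x 0 i)].
  have -> : [set x : 'rV[R]_K | forall i, A (lift ord0 i) (x 0 i)] =
      \bigcap_(i in [set: 'I_K])
        ((fun x : 'rV[R]_K => x 0 i) @^-1` A (lift ord0 i)).
    by apply/seteqP; split=> [x H i _|x H i]; [exact: H|exact: (H i I)].
  apply: fin_bigcap_measurable => [|i _]; first exact: finite_finset.
  rewrite -[X in measurable X]setTI.
  exact: (@measurable_rV_coord R K i measurableT _ (mA _)).
rewrite big_ord_recl -IH// -lebesgue_rV_step_box//; congr (lebesgue_rV_step _ _).
apply/seteqP; split=> x /=.
  by move=> H; split=> // i; rewrite mxE.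
move=> [H0 H] i; case: (unliftP ord0 i) => [k ->|->//].
by have := H k; rewrite mxE.
Qed.

Definition dotv (R : realType) (L : nat) (u v : 'rV[R]_L) : R :=
  \sum_(j < L) u 0 j * v 0 j.

(* The library norm `|u| on 'rV[R]_L is the sup norm; it induces the same
   topology. *)
Definition enorm (R : realType) (L : nat) (u : 'rV[R]_L) : R :=
  Num.sqrt (dotv u u).

Definition convex_hull (R : realType) (L : nat) (A : set 'rV[R]_L) :
    set 'rV[R]_L :=
  [set y | exists (n : nat) (w : 'I_n -> R) (a : 'I_n -> 'rV[R]_L),
    [/\ forall i, 0 <= w i, \sum_(i < n) w i = 1, forall i, A (a i)
      & y = \sum_(i < n) w i *: a i]].

Definition sup_norm (T : Type) (R : realType) (g : T -> R) : R :=
  sup (range (fun x => `|g x|)).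

Section density.
Context {R : realType} {K : nat}.
Implicit Types (f g : 'rV[R]_K -> R).

Definition is_density f : Prop :=
  [/\ measurable_fun setT f, forall x, 0 <= f x
    & (\int[lebesgue_rV]_x (f x)%:E = 1)%E].

Definition supp f : set 'rV[R]_K :=
  [set x | forall U : set 'rV[R]_K, open U -> U x ->
    (0 < \int[lebesgue_rV]_(y in U) (f y)%:E)%E].

Definition expect f g : R := \int[lebesgue_rV]_x (f x * g x).

Context {L : nat}.
Implicit Types T : 'rV[R]_K -> 'rV[R]_L.

Definition has_moment f T : Prop := forall j : 'I_L,
  lebesgue_rV.-integrable setT (fun x => (f x * T x 0 j)%:E).

Definition moment f T : 'rV[R]_L := \row_j expect f (fun x => T x 0 j).

Definition affine_independent_on (S : set 'rV[R]_K) T : Prop :=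
  forall (l : 'rV[R]_L) (mu : R), (l, mu) <> (0, 0) ->
    exists2 x, S x & dotv l (T x) + mu != 0.

Definition C_alpha f T (a : R) : \bar R :=
  ereal_inf [set (\int[lebesgue_rV]_x
      (f x * (Num.max 0 (Num.min (dotv l (T x - moment f T)) a)) ^+ 2)%:E)%E
    | l in [set l : 'rV[R]_L | enorm l = 1]].

Definition C_infty f T : \bar R := lim (C_alpha f T a @[a --> +oo]).

End density.

Section discretization.
Context {R : realType} {K L I : nat}.
Variables (x : 'I_I -> 'rV[R]_K) (q : 'I_I -> R).
Variables (f : 'rV[R]_K -> R) (T : 'rV[R]_K -> 'rV[R]_L).
Implicit Types (g : 'rV[R]_K -> R) (l : 'rV[R]_L).

Definition partition_fun l : R := \sum_(i < I) q i * expR (dotv l (T (x i))).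

Definition dual_objective l : R := dotv l (moment f T) - ln (partition_fun l).

(* A maximizer exists and is unique when [moment f T] is interior to the convex
   hull of the T (x i); otherwise the value may be arbitrary. *)
Definition lambda_opt : 'rV[R]_L :=
  xget 0 [set l | forall l', dual_objective l' <= dual_objective l].

Definition p_opt (i : 'I_I) : R :=
  q i * expR (dotv lambda_opt (T (x i))) / partition_fun lambda_opt.

Definition err (w : 'I_I -> R) g : R :=
  `|expect f g - \sum_(i < I) w i * g (x i)|.

Definition err_T : R :=
  enorm (moment f T - \sum_(i < I) q i *: T (x i)).

Definition err_bound g (C : R) : \bar R :=
  let a := 1 - err_T ^+ 2 / (2 * C) in
  if 0 < a then (err q g + sup_norm g * Num.sqrt (- 2 * ln a))%:E else +oo%E.

End discretization.

(* Main.v *)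
Require Import Defs.
From mathcomp Require Import all_boot all_order all_algebra.
From mathcomp Require Import all_classical all_reals all_analysis.
From mathcomp Require Import measurable_realfun.
From mathcomp Require Import ring lra.

Set Implicit Arguments.
Unset Strict Implicit.
Unset Printing Implicit Defensive.

Import Order.TTheory GRing.Theory Num.Theory.
Import numFieldNormedType.Exports.

Local Open Scope classical_set_scope.
Local Open Scope ring_scope.

(** Write d for the difference between the Q-mean of T and the moment of f, and
y = T - moment f T.  The proof bounds the difference between the P- and the
Q-expectation of g by the sup norm of g times the total variation sum_i
|p_i - q_i|, and then controls that sum through relative entropy.

Pinsker's inequality ([pinsker]) bounds the total variation by sqrt (2 KL).
Since p is an exponential tilt of q by s_i = <lambda, y_i>, with normalisation
Z = sum_i q_i e^(s_i), the entropy is KL = sum_i p_i s_i - ln Z; stationarity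
of the dual objective along the ray through lambda
([lambda_opt_first_order]) removes the first term, so KL <= - ln Z
([exp_tilt_total_variation]).

It remains to see Z >= 1 - |d|^2 / (2 C), and this lower bound holds for every
lambda ([exponential_sum_ge]).  Write lambda = t u with |u| = 1 and t >= 0.
From e^x >= 1 + x for x <= 0 and e^x >= 1 + x + x^2 / 2 for x >= 0,
  sum_i q_i e^(t <u, y_i>) >= 1 + t <u, d> + (t^2 / 2) sum_i q_i r(<u, y_i>)^2
where r(z) = max(0, min(z, a)).  If the last sum is at least C, minimising the
quadratic in lambda gives the claim.

Hence everything reduces to finding a level a such that, for all large M and
simultaneously for all unit vectors u, the Q_M-mean of r(<u, y>)^2 is at least
C.  As C_alpha is nondecreasing in alpha, some level a has C < C_alpha
([C_alpha_lt]), which is the analogous strict inequality for the f-integrals.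
Passing from f to Q_M for a single u is weak convergence.  Uniformity in u
comes from compactness of the sphere ([near_uniform_truncated_moment]): for v
within e of u coordinatewise, <v, y> >= <u, y> - e |y|_1, so one bounded
continuous test function r(<u, y> - e |y|_1)^2 serves all v near u, and by
monotone convergence its f-integral still exceeds C for small e
([exists_slack]). *)

(** * Pinsker's inequality *)

(** The sign information 0 <= (c - 1) * (u - 1) lets one argument handle both
sides of 1 in the two applications below. *)
Lemma MVT_from1 (R : realType) (F dF : R -> R) (u : R) :
  (forall v : R, 0 < v -> is_derive v 1 F (dF v)) -> 0 < u ->
  exists c, [/\ 0 < c, 0 <= (c - 1) * (u - 1) & F u - F 1 = dF c * (u - 1)].
Proof.
move=> dFE u0.
have cF a b : 0 < a -> {within `[a, b], continuous F}.
  move=> a0; apply: continuous_in_subspaceT => v.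
  rewrite inE/= in_itv/= => /andP[av _].
  by apply: differentiable_continuous; apply/derivable1_diffP;
     case: (dFE v (lt_le_trans a0 av)).
have [u1|u1] := leP u 1.
  have [v|c] := @MVT_segment R F dF u 1 u1 _ (cF _ _ u0).
    by rewrite in_itv/= => /andP[uv _]; apply: dFE; exact: lt_trans uv.
  rewrite in_itv/= => /andP[uc c1] E; exists c; split; last by lra.
    exact: lt_le_trans uc.
  by nra.
have [v|c] := @MVT_segment R F dF 1 u (ltW u1) _ (cF _ _ ltr01).
  by rewrite in_itv/= => /andP[v1 _]; apply: dFE; exact: lt_trans v1.
rewrite in_itv/= => /andP[c1 cu] E; exists c; split => //; first by lra.
by nra.
Qed.

(** This compares ln u with its Pade approximant 2 (u - 1) / (u + 1) at 1: the
difference has derivative (u - 1)^2 / (u (u + 1)^2) >= 0, hence has the sign of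
u - 1. *)
Lemma ln_pade (R : realType) (u : R) : 0 < u ->
  0 <= (u - 1) * ((u + 1) * ln u - 2 * (u - 1)).
Proof.
move=> u0.
pose G (v : R) := ln v - 2 * (v - 1) / (v + 1).
have dG (v : R) : 0 < v ->
    is_derive v 1 G ((v - 1) ^+ 2 / (v * (v + 1) ^+ 2)).
  move=> v0; have v1 : v + 1 != 0 by rewrite gt_eqF// addr_gt0.
  pose Hl := is_derive1_ln v0.
  apply: is_derive_eq.
  rewrite /GRing.scale/=; field.
  by rewrite v1 gt_eqF.
have [c [c0 _]] := MVT_from1 dG u0.
rewrite {1}/G {1}/G ln1 subrr mulr0 mul0r subr0 subr0 => E.
have -> : (u - 1) * ((u + 1) * ln u - 2 * (u - 1)) =
    (u - 1) * ((u + 1) * (ln u - 2 * (u - 1) / (u + 1))).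
  by field; rewrite gt_eqF// addr_gt0.
rewrite E; set k := _ / _.
have k0 : 0 <= k.
  apply: divr_ge0; first exact: sqr_ge0.
  by apply: mulr_ge0; [exact: ltW|exact: sqr_ge0].
have -> : (u - 1) * ((u + 1) * (k * (u - 1))) = (u + 1) * k * (u - 1) ^+ 2.
  by ring.
apply: mulr_ge0 (sqr_ge0 _); apply: mulr_ge0 k0; exact/ltW/addr_gt0.
Qed.

(** The pointwise form of Pinsker's inequality, with u a likelihood ratio.  The
difference of the two sides vanishes at 1, and by [ln_pade] its derivative has
the sign of u - 1. *)
Lemma entropy_ge_sqr (R : realType) (u : R) : 0 < u ->
  3 * (u - 1) ^+ 2 <= (2 * u + 4) * (u * ln u - u + 1).
Proof.
move=> u0.
pose G (v : R) := (2 * v + 4) * (v * ln v - v + 1) - 3 * (v - 1) ^+ 2.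
have dG (v : R) : 0 < v ->
    is_derive v 1 G (4 * ((v + 1) * ln v - 2 * (v - 1))).
  move=> v0; pose Hl := is_derive1_ln v0.
  apply: is_derive_eq.
  rewrite /GRing.scale/=; field.
  by rewrite gt_eqF.
have [c [c0 cu]] := MVT_from1 dG u0.
rewrite {1}/G {1}/G ln1 => E.
have cp := ln_pade c0.
suff : 0 <= 4 * ((c + 1) * ln c - 2 * (c - 1)) * (u - 1) by lra.
have [->|c1] := eqVneq c 1; first by rewrite ln1; lra.
have c2 : 0 < (c - 1) ^+ 2 by rewrite exprn_even_gt0// subr_eq0.
rewrite -(pmulr_rge0 _ c2).
have -> : (c - 1) ^+ 2 * (4 * ((c + 1) * ln c - 2 * (c - 1)) * (u - 1)) =
  4 * (((c - 1) * ((c + 1) * ln c - 2 * (c - 1))) * ((c - 1) * (u - 1))).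
  by ring.
by apply: mulr_ge0 => //; apply: mulr_ge0.
Qed.

(** With u_i = p_i / q_i, the sum S of the q_i |u_i - 1| is compared with the sum
of the q_i h(u_i), h(u) = u ln u - u + 1, which is the relative entropy.
[entropy_ge_sqr] reads (u - 1)^2 <= (2 u + 4) / 3 * h(u), and the q-mean of
(2 u_i + 4) / 3 is 2; instead of the Cauchy-Schwarz inequality, the
arithmetic-geometric inequality is used with the optimal weight, which is
proportional to S. *)
Lemma pinsker (R : realType) (n : nat) (p q : 'I_n -> R) :
  (forall i, 0 < p i) -> (forall i, 0 < q i) ->
  \sum_(i < n) p i = 1 -> \sum_(i < n) q i = 1 ->
  (\sum_(i < n) `|p i - q i|) ^+ 2 <= 2 * \sum_(i < n) p i * ln (p i / q i).
Proof.
move=> p0 q0 p1 q1; set S := \sum_(i < n) `|_|; set H := \sum_(i < n) _ * _.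
have S0 : 0 <= S by exact: sumr_ge0.
have term i : `|p i - q i| * S <= S ^+ 2 / 6 * p i + S ^+ 2 / 3 * q i
    + (p i * ln (p i / q i) - p i + q i).
  have u0 : 0 < p i / q i by rewrite divr_gt0.
  have := entropy_ge_sqr u0.
  have pE : p i = q i * (p i / q i) by rewrite mulrCA mulfV ?mulr1// gt_eqF.
  set u := p i / q i in u0 pE *; set h := u * ln u - u + 1 => hu.
  rewrite pE.
  have -> : q i * u - q i = q i * (u - 1) by ring.
  have -> : S ^+ 2 / 6 * (q i * u) + S ^+ 2 / 3 * q i +
      (q i * u * ln u - q i * u + q i) =
      q i * (S ^+ 2 / 12 * (2 * u + 4) + h) by rewrite /h; field.
  rewrite normrM (gtr0_norm (q0 i)) -(mulrA (q i)) ler_pM2l//.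
  have h0 : 0 <= h.
    have u4 : 0 < 2 * u + 4 by lra.
    rewrite -(pmulr_rge0 _ u4); apply: le_trans hu.
    by rewrite mulr_ge0 ?sqr_ge0.
  (* (|u - 1| S)^2 <= S^2 (A / 3) h <= (S^2 A / 12 + h)^2 with A = 2 u + 4. *)
  rewrite -(@ler_pXn2r _ 2)// ?nnegrE ?mulr_ge0//; last first.
    by rewrite addr_ge0// !mulr_ge0 ?sqr_ge0//; lra.
  rewrite exprMn real_normK ?num_real//.
  set A := 2 * u + 4 in hu *.
  apply: (@le_trans _ _ (S ^+ 2 / 3 * (A * h))).
    by have := sqr_ge0 S; nra.
  have := sqr_ge0 (S ^+ 2 / 12 * A - h); nra.
have : \sum_(i < n) `|p i - q i| * S <= \sum_(i < n)
    (S ^+ 2 / 6 * p i + S ^+ 2 / 3 * q i + (p i * ln (p i / q i) - p i + q i)).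
  by apply: ler_sum.
rewrite -mulr_suml -/S !big_split/= -!mulr_sumr sumrN p1 q1 -/H; nra.
Qed.

(** * Exponential tilts *)

Lemma weighted_exp_gt0 (R : realType) (n : nat) (q s : 'I_n -> R) :
  (forall i, 0 < q i) -> \sum_(i < n) q i = 1 ->
  0 < \sum_(i < n) q i * expR (s i).
Proof.
move=> q0; case: n q s q0 => [|n] q s q0 q1.
  by move: q1; rewrite big_ord0 => /eqP; rewrite eq_sym oner_eq0.
rewrite big_ord_recl ltr_pwDl ?mulr_gt0 ?expR_gt0// sumr_ge0// => i _.
by rewrite mulr_ge0 ?expR_ge0// ltW.
Qed.

(** For an exponential tilt, ln (p_i / q_i) = s_i - ln Z, so the relative entropy
is the p-mean of s minus ln Z; the hypothesis says that this mean is at most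
0. *)
Lemma exp_tilt_total_variation (R : realType) (n : nat) (q s : 'I_n -> R) :
  (forall i, 0 < q i) -> \sum_(i < n) q i = 1 ->
  let Z := \sum_(i < n) q i * expR (s i) in
  let p i := q i * expR (s i) / Z in
  \sum_(i < n) q i * s i * expR (s i) <= 0 ->
  \sum_(i < n) `|p i - q i| <= Num.sqrt (- 2 * ln Z).
Proof.
move=> q0 q1 Z p D0.
have w0 i : 0 < q i * expR (s i) by rewrite mulr_gt0 ?expR_gt0.
have Z0 : 0 < Z by exact: weighted_exp_gt0.
have p0 i : 0 < p i by rewrite divr_gt0.
have p1 : \sum_(i < n) p i = 1 by rewrite -mulr_suml mulfV// gt_eqF.
have KL : \sum_(i < n) p i * ln (p i / q i) <= - ln Z.
  have E i : p i * ln (p i / q i) = q i * s i * expR (s i) / Z - p i * ln Z.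
    have -> : p i / q i = expR (s i) / Z.
      by rewrite /p; field; rewrite !gt_eqF.
    rewrite ln_div ?posrE ?expR_gt0// expRK /p; ring.
  have pZ : \sum_(i < n) p i * ln Z = ln Z by rewrite -mulr_suml p1 mul1r.
  rewrite (eq_bigr _ (fun i _ => E i)) sumrB pZ gerDr -mulr_suml.
  by rewrite mulr_le0_ge0// invr_ge0 ltW.
rewrite -[leLHS]ger0_norm ?sumr_ge0// -sqrtr_sqr ler_wsqrtr//.
apply: le_trans (pinsker p0 q0 p1 q1) _.
by rewrite mulNr -mulrN ler_pM2l.
Qed.

(** If t = 1 minimises t |-> sum_i q_i e^(t s_i), the derivative there is not
positive.  By convexity, e^(s_i) >= e^(t s_i) (1 + (1 - t) s_i), so minimality
makes the derivative at every t < 1 nonpositive; then t tends to 1. *)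
Lemma tilt_first_order (R : realType) (n : nat) (q s : 'I_n -> R) :
  (forall i, 0 <= q i) ->
  (forall t : R, \sum_(i < n) q i * expR (s i) <=
                 \sum_(i < n) q i * expR (t * s i)) ->
  \sum_(i < n) q i * s i * expR (s i) <= 0.
Proof.
move=> q0 opt.
pose D (t : R) := \sum_(i < n) q i * s i * expR (t * s i).
have Dle (t : R) : t < 1 -> D t <= 0.
  move=> t1; have t0 : 0 < 1 - t by rewrite subr_gt0.
  rewrite -(pmulr_rle0 _ t0) mulr_sumr.
  have le : \sum_(i < n) q i * expR (t * s i) +
      \sum_(i < n) (1 - t) * (q i * s i * expR (t * s i)) <=
      \sum_(i < n) q i * expR (s i).
    rewrite -big_split/=; apply: ler_sum => i _.
    have -> : q i * expR (t * s i) + (1 - t) * (q i * s i * expR (t * s i)) =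
      q i * (expR (t * s i) * (1 + (1 - t) * s i)) by ring.
    apply: ler_wpM2l => //.
    have -> : expR (s i) = expR (t * s i) * expR ((1 - t) * s i).
      by rewrite -expRD; congr expR; ring.
    by rewrite ler_pM2l ?expR_gt0// expR_ge1Dx.
  by have := opt t; lra.
have -> : \sum_(i < n) q i * s i * expR (s i) = D 1.
  by apply: eq_bigr => i _; rewrite mul1r.
have cD : D t @[t --> 1^'-] --> D 1.
  apply: cvg_at_left_filter.
  apply: cvg_big => [|i _]; first exact: add_continuous.
  apply: cvgM; first exact: cvg_cst.
  apply: continuous_cvg; first exact: continuous_expR.
  by apply: cvgM; [exact: cvg_id|exact: cvg_cst].
apply: (cvgr_to_le cD); near=> t; apply: Dle; near: t; exact: nbhs_left_lt.
Unshelve. all: by end_near. Qed.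

(** * The lower bound on the exponential sum *)

Lemma expR_ge_quad (R : realType) (x : R) : 0 <= x ->
  1 + x + x ^+ 2 / 2 <= expR x.
Proof.
move=> x0; pose F (v : R) := expR v - 1 - v - v ^+ 2 / 2.
have dF (v : R) : is_derive v 1 F (expR v - 1 - v).
  by apply: is_derive_eq; rewrite /GRing.scale/=; field.
have cF : {within `[0, x], continuous F}.
  apply: continuous_subspaceT => v.
  by apply: differentiable_continuous; apply/derivable1_diffP; case: (dF v).
have [c _] := MVT_segment x0 (fun v _ => dF v) cF.
rewrite {2}/F expR0 => E.
have : 0 <= (expR c - 1 - c) * (x - 0).
  by rewrite subr0 mulr_ge0//; have := expR_ge1Dx c; lra.
by rewrite -E /F; lra.
Qed.

(** The truncation in the definition of C_alpha. *)
Definition ramp (R : realType) (a z : R) : R := Num.max 0 (Num.min z a).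

(** Truncating y to [0, a] only weakens the quadratic term, and turns it into a
bounded continuous function of y, whose means converge under weak
convergence. *)
Lemma expR_ge_ramp (R : realType) (t y a : R) : 0 <= t ->
  1 + t * y + t ^+ 2 / 2 * ramp a y ^+ 2 <= expR (t * y).
Proof.
move=> t0; have [y0|y0] := leP y 0.
  rewrite /ramp max_l ?expr0n/= ?mulr0 ?addr0 ?expR_ge1Dx//.
  by rewrite ge_min y0.
set m := ramp a y.
have m0 : 0 <= m by rewrite le_max lexx.
have my : m <= y by rewrite ge_max (ltW y0)/= ge_min lexx.
apply: (@le_trans _ _ (1 + t * y + t ^+ 2 / 2 * y ^+ 2)).
  by rewrite lerD2l ler_wpM2l ?divr_ge0 ?exprn_ge0// lerXn2r// nnegrE ltW.
have x0 : 0 <= t * y by rewrite mulr_ge0// ltW.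
by have := expR_ge_quad x0; rewrite exprMn; lra.
Qed.

Section inner_product.
Context {R : realType} {L : nat}.
Implicit Types u v w l d : 'rV[R]_L.

Lemma dotvZl (t : R) u v : dotv (t *: u) v = t * dotv u v.
Proof.
by rewrite /dotv mulr_sumr; apply: eq_bigr => j _; rewrite mxE mulrA.
Qed.

Lemma dotvBr u v w : dotv u (v - w) = dotv u v - dotv u w.
Proof. by rewrite /dotv -sumrB; apply: eq_bigr => j _; rewrite !mxE mulrBr. Qed.

Lemma dotv_sumr (n : nat) u (q : 'I_n -> R) (y : 'I_n -> 'rV[R]_L) :
  dotv u (\sum_(i < n) q i *: y i) = \sum_(i < n) q i * dotv u (y i).
Proof.
rewrite /dotv; under eq_bigr do rewrite summxE mulr_sumr.
rewrite exchange_big/=; apply: eq_bigr => i _; rewrite mulr_sumr.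
by apply: eq_bigr => j _; rewrite mxE mulrCA.
Qed.

Lemma dotvv_ge0 u : 0 <= dotv u u.
Proof. by apply: sumr_ge0 => j _; rewrite -expr2 sqr_ge0. Qed.

Lemma enorm_sqr u : enorm u ^+ 2 = dotv u u.
Proof. by rewrite sqr_sqrtr// dotvv_ge0. Qed.

Lemma enormN u : enorm (- u) = enorm u.
Proof.
rewrite /enorm /dotv; congr Num.sqrt.
by apply: eq_bigr => j _; rewrite !mxE mulrNN.
Qed.

Lemma enorm_gt0 u : u != 0 -> 0 < enorm u.
Proof.
move=> u0; rewrite sqrtr_gt0 lt_neqAle dotvv_ge0 andbT eq_sym.
apply: contra u0 => /eqP uu; apply/eqP/rowP => j; rewrite mxE.
apply/eqP; rewrite -sqrf_eq0 expr2; apply/eqP.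
have := @psumr_eq0P _ _ predT (fun j => u 0 j * u 0 j).
by apply => // k _; rewrite -expr2 sqr_ge0.
Qed.

Lemma enorm_normalize u : u != 0 -> enorm ((enorm u)^-1 *: u) = 1.
Proof.
move=> /enorm_gt0 u0; apply/eqP.
rewrite -(@eqrXn2 _ 2)// ?sqrtr_ge0// expr1n enorm_sqr.
have -> : dotv ((enorm u)^-1 *: u) ((enorm u)^-1 *: u) =
    (enorm u)^-1 ^+ 2 * dotv u u.
  by rewrite /dotv mulr_sumr; apply: eq_bigr => j _; rewrite !mxE; ring.
by rewrite -enorm_sqr exprVn mulVf// gt_eqF// exprn_gt0.
Qed.

(** Young's inequality: the difference of the two sides is the sum of the terms
(C l_j + d_j)^2 / (2 C). *)
Lemma dotv_young (C : R) l d : 0 < C ->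
  - (dotv d d / (2 * C)) <= dotv l d + C / 2 * dotv l l.
Proof.
move=> C0; rewrite -subr_ge0.
have -> : dotv l d + C / 2 * dotv l l - - (dotv d d / (2 * C)) =
    \sum_(j < L) (C * l 0 j + d 0 j) ^+ 2 / (2 * C).
  rewrite /dotv opprK mulr_sumr mulr_suml -!big_split/=.
  by apply: eq_bigr => j _; field; rewrite gt_eqF.
by apply: sumr_ge0 => j _; rewrite divr_ge0 ?sqr_ge0 ?mulr_ge0// ltW.
Qed.

(** Integrating [expR_ge_ramp] against q in the direction u = l / |l| bounds the
exponential sum below by 1 + <l, d> + C / 2 |l|^2, and [dotv_young] minimises
this over l. *)
Lemma exponential_sum_ge (n : nat) (q : 'I_n -> R) (y : 'I_n -> 'rV[R]_L)
    (a C : R) :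
  (forall i, 0 <= q i) -> \sum_(i < n) q i = 1 -> 0 < C ->
  (forall u, enorm u = 1 -> C <=
     \sum_(i < n) q i * ramp a (dotv u (y i)) ^+ 2) ->
  forall l, 1 - enorm (\sum_(i < n) q i *: y i) ^+ 2 / (2 * C) <=
    \sum_(i < n) q i * expR (dotv l (y i)).
Proof.
move=> q0 q1 C0 Cle l; set d := \sum_(i < n) _ *: _.
rewrite enorm_sqr; have dl := dotv_young l d C0.
apply: (@le_trans _ _ (1 + dotv l d + C / 2 * dotv l l)); first by lra.
have [l0|l0] := eqVneq l 0.
  have d0 v : dotv l v = 0.
    by rewrite l0 /dotv big1// => j _; rewrite mxE mul0r.
  rewrite !d0 mulr0 !addr0 -q1; apply: ler_sum => i _.
  by rewrite d0 expR0 mulr1.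
pose t := enorm l; pose u := t^-1 *: l.
have lE : l = t *: u by rewrite scalerA mulfV ?scale1r// gt_eqF// enorm_gt0.
have uC := Cle u (enorm_normalize l0).
have t0 : 0 <= t by exact: sqrtr_ge0.
have tE : dotv l l = t ^+ 2 by rewrite enorm_sqr.
rewrite dotv_sumr tE.
have : \sum_(i < n) q i * (1 + dotv l (y i) + t ^+ 2 / 2 *
    ramp a (dotv u (y i)) ^+ 2) <=
    \sum_(i < n) q i * expR (dotv l (y i)).
  apply: ler_sum => i _; apply: ler_wpM2l => //.
  by rewrite lE dotvZl expR_ge_ramp.
apply: le_trans.
under [leRHS]eq_bigr do rewrite !mulrDr mulr1 [X in _ + _ + X]mulrCA.
rewrite !big_split/= q1 -mulr_sumr lerD2l.
by have := sqr_ge0 t; nra.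
Qed.

End inner_product.

(** * The error at a fixed discretization *)

Section fixed_discretization.
Context {R : realType} {K L n : nat}.
Variables (x : 'I_n -> 'rV[R]_K) (q : 'I_n -> R).
Variables (f : 'rV[R]_K -> R) (T : 'rV[R]_K -> 'rV[R]_L).
Hypotheses (q0 : forall i, 0 < q i) (q1 : \sum_(i < n) q i = 1).

Let y i := T (x i) - moment f T.
Let lam := lambda_opt x q f T.

Lemma partition_funE (l : 'rV[R]_L) : partition_fun x q T l =
  (\sum_(i < n) q i * expR (dotv l (y i))) * expR (dotv l (moment f T)).
Proof.
rewrite mulr_suml; apply: eq_bigr => i _.
by rewrite -mulrA -expRD dotvBr subrK.
Qed.

(** Centring T at the moment absorbs the linear part of the dual objective. *)
Lemma dual_objectiveE (l : 'rV[R]_L) : dual_objective x q f T l =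
  - ln (\sum_(i < n) q i * expR (dotv l (y i))).
Proof.
rewrite /dual_objective partition_funE lnM ?posrE ?expR_gt0//.
  by rewrite expRK; ring.
exact: weighted_exp_gt0.
Qed.

Lemma p_optE i : p_opt x q f T i = q i * expR (dotv lam (y i)) /
  \sum_(j < n) q j * expR (dotv lam (y j)).
Proof.
rewrite /p_opt -/lam partition_funE dotvBr expRB; field.
by rewrite !gt_eqF ?expR_gt0// weighted_exp_gt0.
Qed.

(** Comparing lam with its multiples t *: lam reduces optimality to the
one-variable statement [tilt_first_order]. *)
Lemma lambda_opt_first_order :
  \sum_(i < n) q i * dotv lam (y i) * expR (dotv lam (y i)) <= 0.
Proof.
rewrite /lam /lambda_opt; case: xgetP => [l _ lmax|_]; last first.
  (* In the absence of a maximizer, lam is the default value 0. *)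
  rewrite big1// => i _.
  rewrite (_ : dotv _ _ = 0) ?mulr0 ?mul0r//.
  by rewrite /dotv big1// => j _; rewrite mxE mul0r.
apply: tilt_first_order => [i|t]; first exact: ltW.
have /= := lmax (t *: l); rewrite !dual_objectiveE lerN2 ler_ln ?posrE.
- by under [X in _ <= X -> _]eq_bigr do rewrite dotvZl.
- exact: weighted_exp_gt0.
- exact: weighted_exp_gt0.
Qed.

Lemma err_p_opt_le (g : 'rV[R]_K -> R) (a C : R) :
  bounded_fun g -> 0 < C ->
  (forall u, enorm u = 1 -> C <=
     \sum_(i < n) q i * ramp a (dotv u (y i)) ^+ 2) ->
  ((err x f (p_opt x q f T) g)%:E <= err_bound x q f T g C)%E.
Proof.
move=> bg C0 Cle; rewrite /err_bound; case: ifPn => [a0|_]; last exact: leey.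
rewrite lee_fin.
set p := p_opt x q f T; set Z := \sum_(j < n) q j * expR (dotv lam (y j)).
have gle z : `|g z| <= sup_norm g.
  have [B [_ gB]] := bg.
  apply: ub_le_sup; last by exists z.
  by exists (B + 1) => _ [w _ <-]; apply: gB => //; rewrite ltrDl.
have TV : \sum_(i < n) `|p i - q i| <= Num.sqrt (- 2 * ln Z).
  have := exp_tilt_total_variation q0 q1 lambda_opt_first_order.
  by under eq_bigr do rewrite -p_optE.
have dE : err_T x q f T = enorm (\sum_(i < n) q i *: y i).
  rewrite /err_T -enormN opprB /y; congr enorm.
  under [RHS]eq_bigr do rewrite scalerBr.
  by rewrite sumrB -scaler_suml q1 scale1r.
have Zge : 1 - err_T x q f T ^+ 2 / (2 * C) <= Z.
  by rewrite dE; apply: (exponential_sum_ge _ q1 C0 Cle) => i; exact: ltW.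
have sup0 : 0 <= sup_norm g by apply: le_trans (gle 0).
apply: (@le_trans _ _ (err x f q g + \sum_(i < n) `|p i - q i| * sup_norm g)).
  rewrite /err -lerBlDl.
  apply: le_trans (lerB_dist _ _) _.
  rewrite opprB addrC subrKA -sumrB.
  apply: le_trans (ler_norm_sum _ _ _) _; apply: ler_sum => i _.
  by rewrite -mulrBl normrM distrC ler_wpM2l.
rewrite lerD2l -mulr_suml mulrC ler_wpM2l//.
apply: (le_trans TV); apply: ler_wsqrtr.
rewrite ler_nM2l// ler_ln// posrE; exact: weighted_exp_gt0.
Qed.

End fixed_discretization.

(** * The truncation and the sphere *)

Lemma ramp_ge0 (R : realType) (a z : R) : 0 <= ramp a z.
Proof. by rewrite le_max lexx. Qed.

Lemma ramp_sqr_le (R : realType) (a a' z z' : R) :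
  a <= a' -> z <= z' -> ramp a z ^+ 2 <= ramp a' z' ^+ 2.
Proof.
move=> aa zz; rewrite lerXn2r ?nnegrE ?ramp_ge0//.
by apply: le_max2 => //; exact: le_min2.
Qed.

Lemma ramp_sqr_bound (R : realType) (a z : R) : ramp a z ^+ 2 <= a ^+ 2.
Proof.
have [a0|a0] := leP a 0.
  have -> : ramp a z = 0 by apply/max_l; rewrite ge_min a0 orbT.
  by rewrite expr0n sqr_ge0.
rewrite lerXn2r ?nnegrE ?ramp_ge0 ?(ltW a0)//.
by rewrite ge_max (ltW a0) ge_min lexx orbT.
Qed.

Lemma continuous_ramp_sqr (R : realType) (a : R) :
  continuous (fun z => ramp a z ^+ 2).
Proof.
move=> z.
have cr : {for z, continuous (ramp a)}.
  apply: (@continuous_max _ _ (cst 0)); first exact: cst_continuous.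
  apply: (@continuous_min _ _ id (cst a)); last exact: cst_continuous.
  exact: cvg_id.
exact: (cvgM cr cr).
Qed.

(** The dual of the sup norm that generates the topology of row vectors: it
measures the effect on <u, y> of moving u within a ball. *)
Definition norm1 (R : realType) (L : nat) (u : 'rV[R]_L) : R :=
  \sum_(j < L) `|u 0 j|.

Lemma norm1_ge0 (R : realType) (L : nat) (u : 'rV[R]_L) : 0 <= norm1 u.
Proof. exact: sumr_ge0. Qed.

Lemma dotv_perturb (R : realType) (L : nat) (u v y : 'rV[R]_L) (e : R) :
  ball u e v -> dotv u y - e * norm1 y <= dotv v y.
Proof.
move=> [_ uv]; rewrite lerBlDr -lerBlDl /dotv -sumrB mulr_sumr.
apply: ler_sum => j _; rewrite -mulrBl.
apply: le_trans (ler_norm _) _; rewrite normrM ler_wpM2r//.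
exact/ltW/uv.
Qed.

Lemma continuous_dotv (R : realType) (L : nat) (u : 'rV[R]_L) :
  continuous (dotv u).
Proof.
apply: continuous_big => [|j _]; first exact: add_continuous.
move=> y.
exact: (continuousM (@cst_continuous _ _ (u 0 j) y)
  (@coord_continuous R 1 L 0 j y)).
Qed.

Lemma continuous_norm1 (R : realType) (L : nat) :
  continuous (@norm1 R L).
Proof.
apply: continuous_big => [|j _]; first exact: add_continuous.
move=> y; exact: (continuous_comp (@coord_continuous R 1 L 0 j y)
  (@norm_continuous _ _ _)).
Qed.

(** The sphere is closed in the compact box [-1, 1]^L. *)
Lemma compact_sphere (R : realType) (L : nat) :
  compact [set u : 'rV[R]_L | enorm u = 1].
Proof.
have box := @rV_compact R L (fun=> `[-1, 1]%classic)
  (fun=> @segment_compact R (-1) 1).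
apply: subclosed_compact box _.
  have -> : [set u : 'rV[R]_L | enorm u = 1] =
      (fun u => dotv u u) @^-1` [set r | r = 1].
    apply/seteqP; split => u /=.
      by rewrite -enorm_sqr => ->; rewrite expr1n.
    by rewrite /enorm => ->; rewrite sqrtr1.
  apply: preimage_closed (@closed_eq _ 1) => u _.
  apply: (@continuous_big _ _ +%R) => [|j _ v]; first exact: add_continuous.
  exact: (continuousM (@coord_continuous R 1 L 0 j v)
    (@coord_continuous R 1 L 0 j v)).
move=> u /= u1 j; rewrite in_itv/= -ler_norml -(@ler_pXn2r _ 2)// ?nnegrE//.
rewrite real_normK ?num_real// expr1n.
have -> : 1 = dotv u u by rewrite -enorm_sqr u1 expr1n.
rewrite /dotv (bigD1 j)//= -expr2 lerDl sumr_ge0// => k _.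
by rewrite -expr2 sqr_ge0.
Qed.

(** * Integrals against the density *)

Section density_integrals.
Context {R : realType} {K L : nat}.
Variables (f : 'rV[R]_K -> R).
Hypothesis df : is_density f.

Lemma continuous_measurable_rV (h : 'rV[R]_K -> R) :
  continuous h -> measurable_fun setT h.
Proof.
move=> /continuousP ch.
apply: (measurability _ (RGenOpens.measurableE R)).
move=> _ [_ [a [b ->] <-]]; rewrite setTI; apply: open_measurable_mx.
by apply: ch; exact: interval_open.
Qed.

Lemma measurable_density_mul (h : 'rV[R]_K -> R) :
  continuous h -> measurable_fun setT (fun z => (f z * h z)%:E).
Proof.
move=> ch; apply/measurable_EFinP; apply: measurable_funM.
  by case: df.
exact: continuous_measurable_rV.
Qed.

(** The bound makes the integral finite, so that the real-valued expectation
carries the same information as the extended one. *)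
Lemma expectE (h : 'rV[R]_K -> R) (B : R) : continuous h ->
  (forall z, 0 <= h z <= B) ->
  (expect f h)%:E = (\int[lebesgue_rV]_z (f z * h z)%:E)%E.
Proof.
move=> ch hB; have [mf f0 f1] := df.
have B0 : 0 <= B by have /andP[] := hB 0; exact: le_trans.
rewrite /expect /Rintegral fineK// ge0_fin_numE; last first.
  apply: integral_ge0 => z _; rewrite lee_fin mulr_ge0//.
  by case/andP: (hB z).
apply: (@le_lt_trans _ _ (\int[lebesgue_rV]_z ((f z)%:E * B%:E))%E).
  apply: ge0_le_integral => //.
  - move=> z _; rewrite lee_fin mulr_ge0//; by case/andP: (hB z).
  - exact: measurable_density_mul.
  - by apply/measurable_EFinP; apply: measurable_funM.
  - by move=> z _; rewrite lee_fin ler_wpM2l//; case/andP: (hB z).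
rewrite ge0_integralZr ?lee_fin//.
- by rewrite f1 mul1e ltry.
- exact/measurable_EFinP.
- by move=> z _; rewrite lee_fin.
Qed.

Lemma continuous_slack (y : 'rV[R]_K -> 'rV[R]_L) (a e : R) (u : 'rV[R]_L) :
  continuous y ->
  continuous (fun z => ramp a (dotv u (y z) - e * norm1 (y z)) ^+ 2).
Proof.
move=> cy z.
have cD : {for z, continuous (fun t => dotv u (y t))}.
  exact: continuous_comp (cy z) (@continuous_dotv _ _ u _).
have cN : {for z, continuous (fun t => norm1 (y t))}.
  exact: continuous_comp (cy z) (@continuous_norm1 _ _ _).
have cw : {for z, continuous (fun t => dotv u (y t) - e * norm1 (y t))}.
  exact: continuousB cD (continuousM (@cst_continuous _ _ e z) cN).
exact: continuous_comp cw (@continuous_ramp_sqr _ a _).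
Qed.

(** The functions of [continuous_slack] with e = 1 / (k + 1) increase with k to
the case e = 0, so monotone convergence applies. *)
Lemma exists_slack (y : 'rV[R]_K -> 'rV[R]_L) (a C : R) (u : 'rV[R]_L) :
  continuous y ->
  (C%:E < \int[lebesgue_rV]_z (f z * ramp a (dotv u (y z)) ^+ 2)%:E)%E ->
  exists k : nat, C < expect f
    (fun z => ramp a (dotv u (y z) - k.+1%:R^-1 * norm1 (y z)) ^+ 2).
Proof.
move=> cy Clt; have [mf f0 f1] := df.
pose h (k : nat) z := ramp a (dotv u (y z) - k.+1%:R^-1 * norm1 (y z)) ^+ 2.
have ch k : continuous (h k) by exact: continuous_slack.
have hB k z : 0 <= h k z <= a ^+ 2 by rewrite sqr_ge0 ramp_sqr_bound.
(* If no k works, the limit integral is at most C. *)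
apply: contrapT => /forallNP Cge.
have h_nd z : {homo (fun k => (f z * h k z)%:E) :
    k k' / (k <= k')%N >-> (k <= k')%E}.
  move=> k k' kk'; rewrite lee_fin ler_wpM2l// ramp_sqr_le//.
  rewrite lerD2l lerN2 ler_wpM2r ?norm1_ge0// lef_pV2 ?posrE//.
  by rewrite ler_nat.
have fh_ge0 k z : (0 <= (f z * h k z)%:E)%E.
  by rewrite lee_fin mulr_ge0//; case/andP: (hB k z).
have cvgI := @cvg_monotone_convergence _ _ R lebesgue_rV setT measurableT
  (fun k z => (f z * h k z)%:E) (fun k => measurable_density_mul (ch k))
  (fun k z _ => fh_ge0 k z) (fun z _ => h_nd z).
have : (\int[lebesgue_rV]_z limn (fun k => (f z * h k z)%:E) <= C%:E)%E.
  apply: (cvge_to_le cvgI); apply: nearW => k.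
  by rewrite -(expectE (ch k) (hB k)) lee_fin leNgt; exact/negP/Cge.
apply/negP; rewrite -ltNge; congr (_ < _)%E: Clt.
apply: eq_integral => z _; apply/esym/cvg_lim => //.
have wk : dotv u (y z) - k.+1%:R^-1 * norm1 (y z) @[k --> \oo] -->
    dotv u (y z).
  rewrite -[X in _ --> X]subr0; apply: cvgB; first exact: cvg_cst.
  rewrite -(mul0r (norm1 (y z))); apply: cvgM; last exact: cvg_cst.
  exact: cvg_harmonic.
have hk : h k z @[k --> \oo] --> ramp a (dotv u (y z)) ^+ 2.
  exact: cvg_comp wk (@continuous_ramp_sqr _ a _).
apply: cvg_EFin; first exact: nearW.
exact: cvgM (cvg_cst (f z)) hk.
Qed.

End density_integrals.

(** * Uniformity in the direction *)

(** For each unit vector u, [exists_slack] provides a test function that lies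
below the truncated square for all v in a ball around u and whose integral
exceeds C; weak convergence transfers this to large M, uniformly in v.
Compactness of the sphere then leaves finitely many conditions on M. *)
Lemma near_uniform_truncated_moment (R : realType) (K L : nat)
    (f : 'rV[R]_K -> R) (y : 'rV[R]_K -> 'rV[R]_L)
    (I : nat -> nat) (x : forall M : nat, 'I_(I M) -> 'rV[R]_K)
    (q : forall M : nat, 'I_(I M) -> R) (a C : R) :
  is_density f -> continuous y ->
  (\forall M \near \oo, forall i, 0 <= q M i) ->
  (forall h : 'rV[R]_K -> R, continuous h -> bounded_fun h ->
    \sum_(i < I M) q M i * h (x M i) @[M --> \oo] --> expect f h) ->
  (forall u, enorm u = 1 -> (C%:E <
     \int[lebesgue_rV]_z (f z * ramp a (dotv u (y z)) ^+ 2)%:E)%E) ->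
  \forall M \near \oo, forall u, enorm u = 1 ->
    C <= \sum_(i < I M) q M i * ramp a (dotv u (y (x M i))) ^+ 2.
Proof.
move=> df cy q0 weak Clt.
have /compact_near_coveringP cov := @compact_sphere R L.
apply: (cov _ _ (fun M u =>
  C <= \sum_(i < I M) q M i * ramp a (dotv u (y (x M i))) ^+ 2)) => u u1.
have [k Ck] := exists_slack df cy (Clt u u1).
set h := fun z => _ in Ck.
have ch : continuous h by exact: continuous_slack.
have bh : bounded_fun h.
  exists (a ^+ 2); split; first exact: num_real.
  move=> B aB z _ /=; rewrite ger0_norm ?sqr_ge0//.
  exact: le_trans (ramp_sqr_bound _ _) (ltW aB).
have near_h := cvgr_gt _ (weak h ch bh) _ Ck.
near=> v M => /=.
have CM : C < \sum_(i < I M) q M i * h (x M i) by near: M; exact: near_h.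
have qM : forall i, 0 <= q M i by near: M; exact: q0.
apply: le_trans (ltW CM) _; apply: ler_sum => i _.
apply: ler_wpM2l => //; apply: ramp_sqr_le => //; apply: dotv_perturb.
by near: v; apply: nbhsx_ballx; rewrite invr_gt0.
Unshelve. all: by end_near. Qed.

(** C_alpha is nondecreasing in alpha, so its limit C_infty is a supremum. *)
Lemma C_alpha_lt (R : realType) (K L : nat) (f : 'rV[R]_K -> R)
    (T : 'rV[R]_K -> 'rV[R]_L) (C : R) :
  is_density f -> continuous T -> (C%:E < C_infty f T)%E ->
  exists a, (C%:E < C_alpha f T a)%E.
Proof.
move=> df cT.
have nd : {homo C_alpha f T : a b / a <= b >-> (a <= b)%E}.
  move=> a b ab; apply: le_ereal_inf_tmp => _ [u u1 <-].
  apply: (@le_trans _ _ (\int[lebesgue_rV]_z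
    (f z * ramp a (dotv u (T z - moment f T)) ^+ 2)%:E)%E).
    by apply: ereal_inf_lbound; exists u.
  have [_ f0 _] := df.
  have mramp c : measurable_fun setT
      (fun z => (f z * ramp c (dotv u (T z - moment f T)) ^+ 2)%:E).
    apply: measurable_density_mul => // z.
    have cy : {for z, continuous (fun t => T t - moment f T)}.
      by apply: continuousB; [exact: cT|exact: cst_continuous].
    have cD := continuous_comp cy (@continuous_dotv _ _ u _).
    exact: continuous_comp cD (@continuous_ramp_sqr _ c _).
  apply: ge0_le_integral => //.
  - by move=> z _; rewrite lee_fin mulr_ge0// sqr_ge0.
  - exact: (mramp b).
  - by move=> z _; rewrite lee_fin ler_wpM2l// ramp_sqr_le.
rewrite /C_infty (cvg_lim _ (nondecreasing_cvge nd))// => /ereal_sup_gt.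
by move=> [_ [a _ <-] Ca]; exists a.
Qed.

Theorem theorem4 (R : realType) (K L : nat)
    (f : 'rV[R]_K -> R) (T : 'rV[R]_K -> 'rV[R]_L)
    (I : nat -> nat) (x : forall M : nat, 'I_(I M) -> 'rV[R]_K)
    (q : forall M : nat, 'I_(I M) -> R)
    (g : 'rV[R]_K -> R) (C : R) :
  is_density f ->
  continuous T ->
  has_moment f T ->
  (forall M, (0 < M)%N ->
    [/\ injective (@x M), forall i, 0 < q M i & \sum_(i < I M) q M i = 1]) ->
  affine_independent_on (supp f) T ->
  (forall M, (0 < M)%N ->
    (convex_hull [set T (x M i) | i in [set: 'I_(I M)]])° (moment f T)) ->
  (forall h : 'rV[R]_K -> R, continuous h -> bounded_fun h ->
    \sum_(i < I M) q M i * h (x M i) @[M --> \oo] --> expect f h) ->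
  (\sum_(i < I M) q M i *: T (x M i) @[M --> \oo] --> moment f T) ->
  continuous g -> bounded_fun g ->
  0 < C -> (C%:E < C_infty f T)%E ->
  exists2 MC : nat, (0 < MC)%N & forall M : nat, (MC <= M)%N ->
    ((err (x M) f (p_opt (x M) (q M) f T) g)%:E
       <= err_bound (x M) (q M) f T g C)%E.
Proof.
move=> df cT _ disc _ _ weak _ _ bg C0 Cinf.
have [a Ca] := C_alpha_lt df cT Cinf.
have cy : continuous (fun z => T z - moment f T).
  by move=> z; apply: continuousB; [exact: cT|exact: cst_continuous].
have q0 : \forall M \near \oo, forall i, 0 <= q M i.
  by exists 1%N => // M /disc[_ q0 _] i; exact: ltW.
have Clt u : enorm u = 1 -> (C%:E < \int[lebesgue_rV]_z
    (f z * ramp a (dotv u (T z - moment f T)) ^+ 2)%:E)%E.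
  by move=> u1; apply: lt_le_trans Ca _; apply: ereal_inf_lbound; exists u.
have [N _ CN] := near_uniform_truncated_moment df cy q0 weak Clt.
exists N.+1 => // M NM.
have [_ qM0 qM1] := disc M (leq_ltn_trans (leq0n N) NM).
exact: (err_p_opt_le qM0 qM1 bg C0 (CN M (ltnW NM))).
Qed.
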